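(* (Within minimal logic, using the principle $\exists\mathrm{WF}_{\mathbb{N}}$.) If $n \in \mathbb{N}$ is such that $\mathrm{Coprime}(n)$, then there is a prime number $p$ with $p \mid n$.
   Context: For $x \in \mathbb{N}$, define $$\mathrm{Prime}(x) :\Leftrightarrow x > 1 \ \&\ \forall_{y \in \mathbb{N}}\big(y \mid x \Rightarrow y =_{\mathbb{N}} 1 \vee y =_{\mathbb{N}} x\big),$$ $$\mathrm{Coprime}(x) :\Leftrightarrow x > 1 \ \&\ \exists_{y \in \mathbb{N}}\big(y \mid x \ \&\ y \neq_{\mathbb{N}} 1 \ \&\ y \neq_{\mathbb{N}} x\big)$$ (the latter is equivalent to $x > 1$ and the existence of $y$ with $y \mid x$ and $1 < y < x$). A prime number is a $p \in \mathbb{N}$ with $\mathrm{Prime}(p)$. Here $\neq_{\mathbb{N}}$ is the (decidable) inequality on $\mathbb{N}$. Minimal logic means intuitionistic logic without the ex falso scheme $\bot_{\mathbb{N}} \Rightarrow Q$, where $\bot_{\mathbb{N}} := (0 =_{\mathbb{N}} 1)$ and $Q$ is arbitrary. The principle $\exists\mathrm{WF}_{\mathbb{N}}$: for all formulas $P(x), Q(x)$ on $\mathbb{N}$ that respect $=_{\mathbb{N}}$, $$\Big[\exists_{x \in \mathbb{N}} Q(x) \ \&\ \forall_{x \in \mathbb{N}}\Big(Q(x) \Rightarrow \big[P(x) \vee \exists_{y \in \mathbb{N}}(y < x \ \&\ Q(y))\big]\Big)\Big] \Rightarrow \exists_{x \in \mathbb{N}} P(x).$$ *)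

(* Defs.v *)
From Stdlib Require Import List.
Import ListNotations.

(** First-order arithmetic with de Bruijn indices: [Var k] refers to the
    [k]-th enclosing quantifier, counted from the inside. *)

Inductive term : Type :=
| Var (k : nat)
| Zero
| Succ (t : term)
| Plus (s t : term)
| Mult (s t : term).

(** There is no constructor for falsity: in minimal logic over the natural
    numbers, falsity is the equation [0 = 1], see [Bot]. *)
Inductive form : Type :=
| Eq (s t : term)
| And (A B : form)
| Or (A B : form)
| Imp (A B : form)
| All (A : form)
| Ex (A : form).

Declare Scope form_scope.
Delimit Scope form_scope with form.
Bind Scope form_scope with form.
Notation "s == t" := (Eq s t) (at level 70, no associativity) : form_scope.
Notation "A /\ B" := (And A B) : form_scope.
Notation "A \/ B" := (Or A B) : form_scope.
Notation "A ==> B" := (Imp A B) (at level 90, right associativity) : form_scope.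

Definition scons (t : term) (s : nat -> term) (k : nat) : term :=
  match k with 0 => t | S k => s k end.

Fixpoint tsubst (s : nat -> term) (t : term) : term :=
  match t with
  | Var k => s k
  | Zero => Zero
  | Succ t => Succ (tsubst s t)
  | Plus t u => Plus (tsubst s t) (tsubst s u)
  | Mult t u => Mult (tsubst s t) (tsubst s u)
  end.

Definition tlift : term -> term := tsubst (fun k => Var (S k)).

Definition up (s : nat -> term) : nat -> term :=
  scons (Var 0) (fun k => tlift (s k)).

Fixpoint subst (s : nat -> term) (A : form) : form :=
  match A with
  | Eq t u => Eq (tsubst s t) (tsubst s u)
  | And A B => And (subst s A) (subst s B)
  | Or A B => Or (subst s A) (subst s B)
  | Imp A B => Imp (subst s A) (subst s B)
  | All A => All (subst (up s) A)
  | Ex A => Ex (subst (up s) A)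
  end.

Definition lift : form -> form := subst (fun k => Var (S k)).

(** [inst A t] removes the outermost binder of [A], replacing it by [t]. *)
Definition inst (A : form) (t : term) : form := subst (scons t Var) A.

(** Minimal logic: no rule is attached to falsity, in particular no ex falso.
    Formulas of [T] may have free variables, which then act as if universally
    quantified. *)

Inductive prv (T : form -> Prop) : list form -> form -> Prop :=
| prv_ax G A : T A -> prv T G A
| prv_hyp G A : In A G -> prv T G A
| prv_impI G A B : prv T (A :: G) B -> prv T G (A ==> B)
| prv_impE G A B : prv T G (A ==> B) -> prv T G A -> prv T G B
| prv_andI G A B : prv T G A -> prv T G B -> prv T G (A /\ B)
| prv_andE1 G A B : prv T G (A /\ B) -> prv T G A
| prv_andE2 G A B : prv T G (A /\ B) -> prv T G B
| prv_orI1 G A B : prv T G A -> prv T G (A \/ B)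
| prv_orI2 G A B : prv T G B -> prv T G (A \/ B)
| prv_orE G A B C :
    prv T G (A \/ B) -> prv T (A :: G) C -> prv T (B :: G) C -> prv T G C
| prv_allI G A : prv T (map lift G) A -> prv T G (All A)
| prv_allE G A t : prv T G (All A) -> prv T G (inst A t)
| prv_exI G A t : prv T G (inst A t) -> prv T G (Ex A)
| prv_exE G A B :
    prv T G (Ex A) -> prv T (A :: map lift G) (lift B) -> prv T G B
| prv_eqI G t : prv T G (t == t)
| prv_eqE G A t u : prv T G (t == u) -> prv T G (inst A t) -> prv T G (inst A u).

Definition One : term := Succ Zero.
Definition Bot : form := Zero == One.
Definition Neq (s t : term) : form := s == t ==> Bot.
Definition Lt (s t : term) : form := Ex (Plus (tlift s) (Succ (Var 0)) == tlift t).
Definition Divides (s t : term) : form := Ex (Mult (tlift s) (Var 0) == tlift t).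

Definition Prime (x : term) : form :=
  Lt One x /\
  All (Divides (Var 0) (tlift x) ==> Var 0 == One \/ Var 0 == tlift x).

(** "Coprime" is used here for composite numbers. *)
Definition Coprime (x : term) : form :=
  Lt One x /\
  Ex (Divides (Var 0) (tlift x) /\ Neq (Var 0) One /\ Neq (Var 0) (tlift x)).

(** In [Respects] and [ExWF] the formulas [P] and [Q] are predicates of
    [Var 0]; their remaining free variables are parameters. [at2 P k] is [P]
    read inside two fresh quantifiers and applied to [Var k]. *)
Definition at2 (P : form) (k : nat) : form :=
  subst (scons (Var k) (fun j => Var (S (S j)))) P.

Definition Respects (P : form) : form :=
  All (All (Var 1 == Var 0 ==> at2 P 1 ==> at2 P 0)).

Definition ExWF (P Q : form) : form :=
  (Ex Q /\ All (Q ==> P \/ Ex (Lt (Var 0) (Var 1) /\ at2 Q 0))) ==> Ex P.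

(** The axioms of Robinson arithmetic and the scheme [ExWF]. Induction is not
    listed because it is derivable: to get [A(a)] from [A(0)] and
    [A(x) ==> A(x+1)], apply [ExWF] to [Q(x) := A(x) ==> A(a)] and the constant
    predicate [P(x) := A(a)]. *)
Inductive arith : form -> Prop :=
| ax_succ_zero : arith (All (Succ (Var 0) == Zero ==> Bot))
| ax_succ_inj : arith (All (All (Succ (Var 1) == Succ (Var 0) ==> Var 1 == Var 0)))
| ax_cases : arith (All (Var 0 == Zero \/ Ex (Var 1 == Succ (Var 0))))
| ax_plus0 : arith (All (Plus (Var 0) Zero == Var 0))
| ax_plusS : arith (All (All
    (Plus (Var 1) (Succ (Var 0)) == Succ (Plus (Var 1) (Var 0)))))
| ax_mult0 : arith (All (Mult (Var 0) Zero == Zero))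
| ax_multS : arith (All (All
    (Mult (Var 1) (Succ (Var 0)) == Plus (Mult (Var 1) (Var 0)) (Var 1))))
| ax_ExWF P Q : arith (Respects P ==> Respects Q ==> ExWF P Q).

(* Main.v *)
Require Import Defs.
From Stdlib Require Import List.
From Stdlib Require Import PeanoNat Lia.
From Stdlib Require Import -(notations) Setoid Morphisms.

(** The mathematics: apply the scheme [ExWF] to
    [Q(x) := 1 < x /\ x | n] and [P(x) := Prime(x) /\ x | n]. The number [n]
    satisfies [Q]. If [x] satisfies [Q], then either [x] is prime, and [P(x)]
    holds, or [x] is composite; in the second case a proper divisor of [x] is
    above [1], below [x], and divides [n], so it is a smaller element of [Q].

    What has to be supplied is the dichotomy [prime_or_coprime]. It is obtained
    constructively. A divisor of [x > 1], and likewise a cofactor, is at most [x]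
    ([factor_le]); equality is decidable ([eq_dec]); so a bounded search for the
    cofactor decides divisibility ([divides_dec]), and a bounded search for the
    divisor decides primality. [bounded_search] is by induction, which follows
    from [ExWF] ([induction_rule]). The searches discard impossible cases by ex
    falso, which is derivable although minimal logic lacks it as a rule: [0 = 1]
    gives [t = t * 1 = t * 0 = 0] for every [t], hence every equation, and all
    formulas are built from equations ([ex_falso]).

    The proofs are carried out inside the calculus, but without handling
    indices. Derivability is closed under substitution ([prv_subst]), and a
    variable that does not occur in a sequent can serve as an eigenvariable.
    Hence the rules for the quantifiers may be used with a term [t] of the
    metalanguage in place of a bound variable ([generalization], [allI], [exE]).
    By [weakening], hypotheses may likewise be facts [G ⊢ A] of the metalanguage,
    transported to every larger context. Provable equality in a context is a
    congruence, so equations are rewritten as usual. *)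

Notation "G ⊢ A" := (prv arith G A%form) (at level 95, no associativity).

(** * Substitution calculus *)

Lemma tsubst_ext s s' t : (forall k, s k = s' k) -> tsubst s t = tsubst s' t.
Proof. intros E; induction t; cbn; congruence. Qed.

Lemma tsubst_comp s s' t :
  tsubst s' (tsubst s t) = tsubst (fun k => tsubst s' (s k)) t.
Proof. induction t; cbn; congruence. Qed.

Lemma tsubst_id s t : (forall k, s k = Var k) -> tsubst s t = t.
Proof. intros E; induction t; cbn; congruence. Qed.

Lemma tsubst_tlift s t : tsubst s (tlift t) = tsubst (fun k => s (S k)) t.
Proof. apply tsubst_comp. Qed.

Lemma tsubst_scons_tlift u t : tsubst (scons u Var) (tlift t) = t.
Proof. rewrite tsubst_tlift. now apply tsubst_id. Qed.

Lemma tsubst_up_tlift s t : tsubst (up s) (tlift t) = tlift (tsubst s t).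
Proof. rewrite tsubst_tlift. symmetry. apply tsubst_comp. Qed.

Lemma up_ext s s' : (forall k, s k = s' k) -> forall k, up s k = up s' k.
Proof. intros E [|k]; cbn; congruence. Qed.

Lemma subst_ext A : forall s s', (forall k, s k = s' k) -> subst s A = subst s' A.
Proof.
  induction A; intros ? ? E; cbn; f_equal; auto using tsubst_ext, up_ext.
Qed.

Lemma subst_id A : forall s, (forall k, s k = Var k) -> subst s A = A.
Proof.
  induction A; intros s0 E; cbn; f_equal; auto using tsubst_id.
  all: apply IHA; intros [|k]; cbn; rewrite ?E; reflexivity.
Qed.

Lemma subst_comp A : forall s s',
  subst s' (subst s A) = subst (fun k => tsubst s' (s k)) A.
Proof.
  induction A; intros s0 s'; cbn; f_equal; auto using tsubst_comp.
  all: rewrite IHA; apply subst_ext; intros [|k]; cbn; auto using tsubst_up_tlift.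
Qed.

Lemma subst_lift s A : subst s (lift A) = subst (fun k => s (S k)) A.
Proof. apply subst_comp. Qed.

Lemma inst_lift A t : inst (lift A) t = A.
Proof. unfold inst. rewrite subst_lift. now apply subst_id. Qed.

Lemma subst_up_lift s A : subst (up s) (lift A) = lift (subst s A).
Proof. rewrite subst_lift. symmetry. apply subst_comp. Qed.

Lemma map_subst_up_lift s G :
  map (subst (up s)) (map lift G) = map lift (map (subst s) G).
Proof. rewrite !map_map. apply map_ext. apply subst_up_lift. Qed.

Lemma subst_inst s A t : subst s (inst A t) = inst (subst (up s) A) (tsubst s t).
Proof.
  unfold inst. rewrite !subst_comp. apply subst_ext. intros [|k]; cbn.
  - reflexivity.
  - symmetry. apply tsubst_scons_tlift.
Qed.

Lemma subst_Lt s a b : subst s (Lt a b) = Lt (tsubst s a) (tsubst s b).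
Proof. unfold Lt; cbn. now rewrite !tsubst_up_tlift. Qed.

Lemma subst_Divides s a b : subst s (Divides a b) = Divides (tsubst s a) (tsubst s b).
Proof. unfold Divides; cbn. now rewrite !tsubst_up_tlift. Qed.

Lemma subst_Neq s a b : subst s (Neq a b) = Neq (tsubst s a) (tsubst s b).
Proof. reflexivity. Qed.

Lemma subst_Prime s a : subst s (Prime a) = Prime (tsubst s a).
Proof.
  unfold Prime; cbn [subst]. rewrite subst_Lt, subst_Divides. cbn.
  now rewrite !tsubst_up_tlift.
Qed.

(** Computes the instance of an explicitly given formula, leaving the defined
    predicates folded. *)
Ltac simpl_inst :=
  unfold inst;
  cbn [subst tsubst One Bot];
  rewrite ?subst_Lt, ?subst_Divides, ?subst_Prime, ?subst_Neq;
  cbn [subst tsubst scons One Bot];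
  rewrite ?tsubst_up_tlift, ?tsubst_scons_tlift;
  cbn [up scons tsubst One Bot];
  fold Bot One.

(** * Structural rules *)

Lemma weakening G G' A : incl G G' -> G ⊢ A -> G' ⊢ A.
Proof.
  intros I H. revert G' I. induction H; intros G' I.
  - now apply prv_ax.
  - apply prv_hyp; auto.
  - apply prv_impI, IHprv. intros ? [->|]; cbn; auto.
  - eapply prv_impE; eauto.
  - apply prv_andI; auto.
  - eapply prv_andE1; eauto.
  - eapply prv_andE2; eauto.
  - apply prv_orI1; auto.
  - apply prv_orI2; auto.
  - eapply prv_orE; eauto; [apply IHprv2|apply IHprv3];
      intros ? [->|]; cbn; auto.
  - apply prv_allI, IHprv. now apply incl_map.
  - apply prv_allE; auto.
  - eapply prv_exI; eauto.
  - eapply prv_exE; eauto. apply IHprv2.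
    intros ? [->|]; cbn; auto. right. eapply incl_map; eauto.
  - apply prv_eqI.
  - eapply prv_eqE; eauto.
Qed.

Lemma subst_at2 s P k : k < 2 -> subst (up (up s)) (at2 P k) = at2 (subst (up s) P) k.
Proof.
  intros L. unfold at2. rewrite !subst_comp. apply subst_ext. intros [|j]; cbn.
  - destruct k as [|[|k]]; [reflexivity..|lia].
  - rewrite tsubst_tlift. apply tsubst_comp.
Qed.

Lemma subst_up_scons_at2 t P : subst (up (scons t Var)) (at2 P 0) = P.
Proof. unfold at2. rewrite subst_comp. apply subst_id. intros [|k]; reflexivity. Qed.

Lemma subst_Respects s P : subst s (Respects P) = Respects (subst (up s) P).
Proof. unfold Respects; cbn [subst]. now rewrite !subst_at2 by lia. Qed.

Lemma subst_ExWF s P Q : subst s (ExWF P Q) = ExWF (subst (up s) P) (subst (up s) Q).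
Proof. unfold ExWF; cbn [subst]. now rewrite subst_at2, subst_Lt by lia. Qed.

(** Every axiom is either closed or an instance of the scheme [ExWF], whose
    parameters may be substituted. *)
Lemma arith_subst s A : arith A -> arith (subst s A).
Proof.
  destruct 1; try (cbn; constructor; fail).
  cbn [subst]. rewrite !subst_Respects, subst_ExWF. constructor.
Qed.

Lemma prv_subst s G A : G ⊢ A -> map (subst s) G ⊢ subst s A.
Proof.
  intros H. revert s. induction H; intros s; cbn [subst map] in *.
  - now apply prv_ax, arith_subst.
  - apply prv_hyp. now apply in_map.
  - now apply prv_impI.
  - eapply prv_impE; eauto.
  - apply prv_andI; auto.
  - eapply prv_andE1; eauto.
  - eapply prv_andE2; eauto.
  - apply prv_orI1; auto.
  - apply prv_orI2; auto.
  - eapply prv_orE; eauto.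
  - apply prv_allI. rewrite <- map_subst_up_lift. auto.
  - rewrite subst_inst. apply prv_allE; auto.
  - eapply prv_exI. rewrite <- subst_inst. auto.
  - eapply prv_exE; eauto. rewrite <- map_subst_up_lift, <- subst_up_lift. apply IHprv2.
  - apply prv_eqI.
  - rewrite subst_inst. eapply prv_eqE; eauto. rewrite <- subst_inst. auto.
Qed.

(** A term or formula sees only finitely many variables. This is what makes a
    fresh variable available in [generalization]. *)
Lemma tsubst_finite t : exists n, forall s s',
  (forall k, k < n -> s k = s' k) -> tsubst s t = tsubst s' t.
Proof.
  induction t as [k| |t [n H]|t [n H] u [m K]|t [n H] u [m K]].
  - exists (S k). cbn. auto.
  - now exists 0.
  - exists n. intros. cbn. f_equal. auto.
  - exists (n + m). intros s s' E. cbn. f_equal; [apply H|apply K]; intros; apply E; lia.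
  - exists (n + m). intros s s' E. cbn. f_equal; [apply H|apply K]; intros; apply E; lia.
Qed.

Lemma up_agree n s s' : (forall k, k < n -> s k = s' k) ->
  forall k, k < S n -> up s k = up s' k.
Proof. intros E [|k] L; cbn; [reflexivity|]. rewrite E by lia. reflexivity. Qed.

Lemma subst_finite A : exists n, forall s s',
  (forall k, k < n -> s k = s' k) -> subst s A = subst s' A.
Proof.
  induction A as [t u|A [n H] B [m K]|A [n H] B [m K]|A [n H] B [m K]|A [n H]|A [n H]].
  - destruct (tsubst_finite t) as [n H], (tsubst_finite u) as [m K].
    exists (n + m). intros s s' E. cbn. f_equal; [apply H|apply K]; intros; apply E; lia.
  - exists (n + m). intros s s' E. cbn. f_equal; [apply H|apply K]; intros; apply E; lia.
  - exists (n + m). intros s s' E. cbn. f_equal; [apply H|apply K]; intros; apply E; lia.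
  - exists (n + m). intros s s' E. cbn. f_equal; [apply H|apply K]; intros; apply E; lia.
  - exists n. intros s s' E. cbn. f_equal. apply H. intros.
    apply (up_agree n); auto.
  - exists n. intros s s' E. cbn. f_equal. apply H. intros.
    apply (up_agree n); auto.
Qed.

Lemma map_subst_finite G : exists n, forall s s',
  (forall k, k < n -> s k = s' k) -> map (subst s) G = map (subst s') G.
Proof.
  induction G as [|A G [m K]].
  - now exists 0.
  - destruct (subst_finite A) as [n H]. exists (n + m).
    intros s s' E. cbn. f_equal; [apply H|apply K]; intros; apply E; lia.
Qed.

(** Take for [t] a variable [N] that is fresh for [G] and [A]. The substitution sending [N] to the newly bound
    variable, and shifting all others, turns that instance into the conclusion.
    Quantifying over all terms [t] hides the choice of [N]. *)
Lemma generalization G A : (forall t, G ⊢ inst A t) -> map lift G ⊢ A.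
Proof.
  intros H.
  destruct (map_subst_finite G) as [m Hm], (subst_finite A) as [n Hn].
  pose (N := n + m).
  pose (s := fun k => if Nat.eq_dec k N then Var 0 else Var (S k)).
  assert (EG : map (subst s) G = map lift G).
  { apply Hm. intros k L. unfold s. destruct Nat.eq_dec; [lia|reflexivity]. }
  assert (EA : subst s (inst A (Var N)) = A).
  { unfold inst. rewrite subst_comp. rewrite <- (subst_id A Var) at 2 by reflexivity.
    apply Hn. intros [|k] L; cbn; unfold s; destruct Nat.eq_dec; auto; lia. }
  rewrite <- EG, <- EA. apply prv_subst, H.
Qed.

(** * Natural deduction *)

Lemma impI G A B :
  (forall G', incl G G' -> G' ⊢ A -> G' ⊢ B) -> G ⊢ A ==> B.
Proof.
  intros H. apply prv_impI, H.
  - intros ?; cbn; auto.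
  - apply prv_hyp; cbn; auto.
Qed.

Lemma orE G A B C : G ⊢ A \/ B ->
  (forall G', incl G G' -> G' ⊢ A -> G' ⊢ C) ->
  (forall G', incl G G' -> G' ⊢ B -> G' ⊢ C) -> G ⊢ C.
Proof.
  intros H HA HB.
  eapply prv_orE; [exact H|apply HA|apply HB];
    try (intros ?; cbn; now auto); apply prv_hyp; cbn; auto.
Qed.

Lemma allI G A : (forall t, G ⊢ inst A t) -> G ⊢ All A.
Proof. intros H. now apply prv_allI, generalization. Qed.

Lemma exE G A C : G ⊢ Ex A ->
  (forall t G', incl G G' -> G' ⊢ inst A t -> G' ⊢ C) -> G ⊢ C.
Proof.
  intros H HC. eapply prv_exE; [exact H|].
  assert (K : map lift G ⊢ A ==> lift C).
  { apply generalization. intros t. change (G ⊢ inst A t ==> inst (lift C) t).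
    rewrite inst_lift. apply impI. exact (HC t). }
  eapply prv_impE.
  - eapply weakening; [|exact K]. intros ?; cbn; auto.
  - apply prv_hyp; cbn; auto.
Qed.

Lemma eq_sym G s t : G ⊢ s == t -> G ⊢ t == s.
Proof.
  intros H.
  pose proof (prv_eqE arith G (Var 0 == tlift s)%form s t H) as K.
  unfold inst in K; cbn in K. rewrite !tsubst_scons_tlift in K.
  apply K, prv_eqI.
Qed.

Lemma eq_trans G s t u : G ⊢ s == t -> G ⊢ t == u -> G ⊢ s == u.
Proof.
  intros H H'.
  pose proof (prv_eqE arith G (tlift s == Var 0)%form t u H') as K.
  unfold inst in K; cbn in K. rewrite !tsubst_scons_tlift in K. auto.
Qed.

(** As a binary relation on terms, so that setoid rewriting applies. *)
Definition eqv G s t : Prop := G ⊢ s == t.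

#[export] Instance eqv_equivalence G : Equivalence (eqv G).
Proof.
  split; intros ?.
  - apply prv_eqI.
  - apply eq_sym.
  - apply eq_trans.
Qed.

(** Leibniz's law for the formula [f(s) == f(x)]; it yields the congruences
    below. *)
Lemma eqv_context G f s t :
  eqv G s t -> eqv G (tsubst (scons s Var) f) (tsubst (scons t Var) f).
Proof.
  intros H.
  pose proof (prv_eqE arith G (tlift (tsubst (scons s Var) f) == f)%form s t H) as K.
  unfold inst in K; cbn in K. rewrite !tsubst_scons_tlift in K.
  apply K, prv_eqI.
Qed.

#[export] Instance Succ_eqv G : Proper (respectful (eqv G) (eqv G)) Succ.
Proof. intros s t. apply (eqv_context G (Succ (Var 0))). Qed.

#[export] Instance Plus_eqv G : Proper (respectful (eqv G) (respectful (eqv G) (eqv G))) Plus.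
Proof.
  intros s s' E t t' E'.
  pose proof (eqv_context G (Plus (Var 0) (tlift t)) _ _ E) as H.
  pose proof (eqv_context G (Plus (tlift s') (Var 0)) _ _ E') as H'.
  cbn in H, H'. rewrite !tsubst_scons_tlift in *. now transitivity (Plus s' t).
Qed.

#[export] Instance Mult_eqv G : Proper (respectful (eqv G) (respectful (eqv G) (eqv G))) Mult.
Proof.
  intros s s' E t t' E'.
  pose proof (eqv_context G (Mult (Var 0) (tlift t)) _ _ E) as H.
  pose proof (eqv_context G (Mult (tlift s') (Var 0)) _ _ E') as H'.
  cbn in H, H'. rewrite !tsubst_scons_tlift in *. now transitivity (Mult s' t).
Qed.

Lemma eqv_weakening G G' s t : incl G G' -> eqv G s t -> eqv G' s t.
Proof. apply weakening. Qed.

(** Replaces the context [G] by a larger one [G'], moving every fact about [G]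
    along. The goal then reads as in ordinary natural deduction. *)
Ltac weaken_all :=
  match goal with
  | I : incl ?G ?G' |- _ =>
      repeat match goal with
      | X : prv arith G _ |- _ => apply (weakening G G' _ I) in X
      | X : eqv G _ _ |- _ => apply (eqv_weakening G G' _ _ I) in X
      | X : forall t, prv arith G (@?F t) |- _ =>
          let Y := fresh in
          pose proof (fun t => weakening G G' _ I (X t)) as Y; cbn beta in Y;
          clear X; rename Y into X
      end; clear I; clear G; rename G' into G
  end.

Tactic Notation "enter" ident(H) := intros ? ? H; weaken_all.
Tactic Notation "enter" ident(t) ident(H) := intros t ? ? H; weaken_all.

(** * Axioms *)

Lemma succ_zero G t : eqv G (Succ t) Zero -> G ⊢ Bot.
Proof.
  apply prv_impE. apply (prv_allE arith G _ t (prv_ax _ _ _ ax_succ_zero)).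
Qed.

Lemma succ_inj G s t : eqv G (Succ s) (Succ t) -> eqv G s t.
Proof.
  apply prv_impE.
  pose proof (prv_allE arith G _ t (prv_allE arith G _ s (prv_ax _ _ _ ax_succ_inj))) as H.
  unfold inst in H; cbn in H. now rewrite !tsubst_scons_tlift in H.
Qed.

Lemma term_cases G t C :
  (forall G', incl G G' -> eqv G' t Zero -> G' ⊢ C) ->
  (forall u G', incl G G' -> eqv G' t (Succ u) -> G' ⊢ C) ->
  G ⊢ C.
Proof.
  intros H0 HS.
  eapply orE; [exact (prv_allE arith G _ t (prv_ax _ _ _ ax_cases))|exact H0|].
  intros G' I H. eapply exE; [exact H|]. intros u G'' I' K.
  unfold inst in K; cbn in K. rewrite !tsubst_scons_tlift in K.
  apply (HS u); [eapply incl_tran; eauto|exact K].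
Qed.

Lemma plus_0_r G t : eqv G (Plus t Zero) t.
Proof. exact (prv_allE arith G _ t (prv_ax _ _ _ ax_plus0)). Qed.

Lemma mult_0_r G t : eqv G (Mult t Zero) Zero.
Proof. exact (prv_allE arith G _ t (prv_ax _ _ _ ax_mult0)). Qed.

Lemma plus_succ_r G s t : eqv G (Plus s (Succ t)) (Succ (Plus s t)).
Proof.
  pose proof (prv_allE arith G _ t (prv_allE arith G _ s (prv_ax _ _ _ ax_plusS))) as H.
  unfold inst in H; cbn in H. now rewrite !tsubst_scons_tlift in H.
Qed.

Lemma mult_succ_r G s t : eqv G (Mult s (Succ t)) (Plus (Mult s t) s).
Proof.
  pose proof (prv_allE arith G _ t (prv_allE arith G _ s (prv_ax _ _ _ ax_multS))) as H.
  unfold inst in H; cbn in H. now rewrite !tsubst_scons_tlift in H.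
Qed.

Lemma Lt_intro G k s t : eqv G (Plus s (Succ k)) t -> G ⊢ Lt s t.
Proof. intros H. apply prv_exI with k. simpl_inst. exact H. Qed.

Lemma Lt_elim G s t C : G ⊢ Lt s t ->
  (forall k G', incl G G' -> eqv G' (Plus s (Succ k)) t -> G' ⊢ C) -> G ⊢ C.
Proof.
  intros H HC. eapply exE; [exact H|]. intros k G' I K.
  revert K; simpl_inst; intros K. eauto.
Qed.

Lemma Divides_intro G k s t : eqv G (Mult s k) t -> G ⊢ Divides s t.
Proof. intros H. apply prv_exI with k. simpl_inst. exact H. Qed.

Lemma Divides_elim G s t C : G ⊢ Divides s t ->
  (forall k G', incl G G' -> eqv G' (Mult s k) t -> G' ⊢ C) -> G ⊢ C.
Proof.
  intros H HC. eapply exE; [exact H|]. intros k G' I K.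
  revert K; simpl_inst; intros K. eauto.
Qed.

(** * Well-foundedness and induction *)

(** The two instances of [P] that occur in [Respects P] differ only in [k]. *)
Lemma inst_at2 s t P k :
  inst (subst (up (scons s Var)) (at2 P k)) t =
  inst P (tsubst (scons t Var) (up (scons s Var) k)).
Proof.
  unfold inst, at2. rewrite !subst_comp. apply subst_ext. intros [|j]; reflexivity.
Qed.

(** Every formula respects equality, by Leibniz's law, so the premises of the
    scheme [ExWF] are always met. *)
Lemma respects G P : G ⊢ Respects P.
Proof.
  apply allI; intros s. apply allI; intros t.
  change (G ⊢ tsubst (scons t Var) (tlift s) == t ==>
    inst (subst (up (scons s Var)) (at2 P 1)) t ==>
    inst (subst (up (scons s Var)) (at2 P 0)) t).
  rewrite !inst_at2. cbn. rewrite tsubst_scons_tlift.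
  apply impI; enter E. apply impI; enter H.
  eapply prv_eqE; eauto.
Qed.

Lemma exWF G P Q : G ⊢ Ex Q ->
  (forall t G', incl G G' -> G' ⊢ inst Q t ->
     G' ⊢ inst P t \/ Ex (Lt (Var 0) (tlift t) /\ Q)) ->
  G ⊢ Ex P.
Proof.
  intros H0 HS.
  assert (W : G ⊢ ExWF P Q).
  { eapply prv_impE; [eapply prv_impE|]; [now apply prv_ax, ax_ExWF|apply respects..]. }
  apply (prv_impE _ _ _ _ W). apply prv_andI; [exact H0|].
  apply allI; intros t. unfold inst. cbn [subst]. rewrite subst_Lt; cbn [up scons tsubst].
  rewrite subst_up_scons_at2. apply impI. exact (HS t).
Qed.

(** To reach [F t], apply [exWF] to [Q(x) := F(x) ==> F(t)] and to the constant
    predicate [F(t)]: [Q] holds at [t], and it descends from [Succ v] to [v] by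
    the induction step, until [Zero] is reached and [F(t)] follows.

    [F] is the induction predicate as a function on terms; the formula [A]
    represents it. *)
Lemma induction_rule G A F :
  (forall t, inst A t = F t) ->
  G ⊢ F Zero ->
  (forall t G', incl G G' -> G' ⊢ F t -> G' ⊢ F (Succ t)) ->
  forall t, G ⊢ F t.
Proof.
  intros E H0 HS t.
  pose (Q := (A ==> lift (F t))%form).
  assert (EQ : forall u, inst Q u = (F u ==> F t)%form).
  { intros u. rewrite <- !E. rewrite <- (inst_lift (inst A t) u) at 1.
    unfold Q. now rewrite <- E. }
  assert (K : G ⊢ Ex (lift (F t))).
  { apply exWF with Q.
    - apply prv_exI with t. rewrite EQ. now apply impI.
    - intros u G1 I1 H. rewrite EQ in H. rewrite inst_lift.
      apply (term_cases G1 u).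
      + intros G2 I2 Z. apply prv_orI1, (prv_impE _ _ (F u)).
        { exact (weakening _ _ _ I2 H). }
        rewrite <- E in *. apply (prv_eqE _ _ _ Zero); [now apply eq_sym|].
        apply (weakening G); [eapply incl_tran; eassumption|exact H0].
      + intros v G2 I2 Z. apply prv_orI2. apply prv_exI with v.
        unfold inst; cbn [subst]. rewrite subst_Lt; cbn [tsubst scons].
        fold (inst Q v). rewrite EQ, tsubst_scons_tlift. apply prv_andI.
        * apply Lt_intro with Zero. rewrite plus_succ_r, plus_0_r. now symmetry.
        * apply impI; intros G3 I3 Hv. apply (prv_impE _ _ (F u)).
          { apply (weakening G1); [eapply incl_tran; eassumption|exact H]. }
          rewrite <- E. apply (prv_eqE _ _ _ (Succ v)).
          { apply (weakening G2); [exact I3|now apply eq_sym]. }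
          rewrite E. apply HS; [|exact Hv].
          eapply incl_tran; [|exact I3]. eapply incl_tran; eassumption. }
  eapply exE; [exact K|]. intros u G' I. now rewrite inst_lift.
Qed.

(** * Arithmetic *)

(** Equations that hold in every context: the induction step then needs no
    larger context. *)
Lemma equation_induction a b f g :
  (forall t, tsubst (scons t Var) a = f t) ->
  (forall t, tsubst (scons t Var) b = g t) ->
  (forall G, eqv G (f Zero) (g Zero)) ->
  (forall G t, eqv G (f t) (g t) -> eqv G (f (Succ t)) (g (Succ t))) ->
  forall G t, eqv G (f t) (g t).
Proof.
  intros Ea Eb H0 HS G.
  apply (induction_rule G (a == b) (fun t => f t == g t)%form); [|apply H0|].
  - intros t. cbn. now rewrite <- Ea, <- Eb.
  - intros t G' _. apply HS.
Qed.

Ltac induct a b :=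
  apply (equation_induction a b);
  [ intros; cbn; rewrite ?tsubst_scons_tlift; reflexivity
  | intros; cbn; rewrite ?tsubst_scons_tlift; reflexivity
  | intros G; cbn beta | intros G ? IH; cbn beta in * ].

Lemma plus_0_l G t : eqv G (Plus Zero t) t.
Proof.
  revert G t. induct (Plus Zero (Var 0)) (Var 0).
  - apply plus_0_r.
  - now rewrite plus_succ_r, IH.
Qed.

Lemma plus_succ_l G s t : eqv G (Plus (Succ s) t) (Succ (Plus s t)).
Proof.
  revert G t. induct (Plus (Succ (tlift s)) (Var 0)) (Succ (Plus (tlift s) (Var 0))).
  - now rewrite !plus_0_r.
  - now rewrite !plus_succ_r, IH.
Qed.

Lemma plus_comm G s t : eqv G (Plus s t) (Plus t s).
Proof.
  revert G t. induct (Plus (tlift s) (Var 0)) (Plus (Var 0) (tlift s)).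
  - now rewrite plus_0_l, plus_0_r.
  - now rewrite plus_succ_r, plus_succ_l, IH.
Qed.

Lemma plus_assoc G s t u : eqv G (Plus s (Plus t u)) (Plus (Plus s t) u).
Proof.
  revert G u.
  induct (Plus (tlift s) (Plus (tlift t) (Var 0))) (Plus (Plus (tlift s) (tlift t)) (Var 0)).
  - now rewrite !plus_0_r.
  - now rewrite !plus_succ_r, IH.
Qed.

Lemma mult_0_l G t : eqv G (Mult Zero t) Zero.
Proof.
  revert G t. induct (Mult Zero (Var 0)) Zero.
  - apply mult_0_r.
  - now rewrite mult_succ_r, IH, plus_0_r.
Qed.

Lemma mult_succ_l G s t : eqv G (Mult (Succ s) t) (Plus (Mult s t) t).
Proof.
  revert G t. induct (Mult (Succ (tlift s)) (Var 0)) (Plus (Mult (tlift s) (Var 0)) (Var 0)).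
  - now rewrite !mult_0_r, plus_0_r.
  - rewrite !mult_succ_r, !plus_succ_r, IH.
    now rewrite <- !plus_assoc, (plus_comm _ s t).
Qed.

Lemma mult_comm G s t : eqv G (Mult s t) (Mult t s).
Proof.
  revert G t. induct (Mult (tlift s) (Var 0)) (Mult (Var 0) (tlift s)).
  - now rewrite mult_0_l, mult_0_r.
  - now rewrite mult_succ_r, mult_succ_l, IH.
Qed.

Lemma mult_plus_r G s t u : eqv G (Mult s (Plus t u)) (Plus (Mult s t) (Mult s u)).
Proof.
  revert G u. induct (Mult (tlift s) (Plus (tlift t) (Var 0)))
    (Plus (Mult (tlift s) (tlift t)) (Mult (tlift s) (Var 0))).
  - now rewrite mult_0_r, !plus_0_r.
  - now rewrite plus_succ_r, !mult_succ_r, IH, plus_assoc.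
Qed.

Lemma mult_assoc G s t u : eqv G (Mult s (Mult t u)) (Mult (Mult s t) u).
Proof.
  revert G u.
  induct (Mult (tlift s) (Mult (tlift t) (Var 0))) (Mult (Mult (tlift s) (tlift t)) (Var 0)).
  - now rewrite !mult_0_r.
  - now rewrite !mult_succ_r, mult_plus_r, IH.
Qed.

Lemma mult_1_r G t : eqv G (Mult t One) t.
Proof. unfold One. now rewrite mult_succ_r, mult_0_r, plus_0_l. Qed.

(** * Ex falso and decidability *)

Lemma eq_of_bot G s t : G ⊢ Bot -> eqv G s t.
Proof.
  intros H. change (eqv G Zero One) in H.
  assert (Z : forall u, eqv G u Zero).
  { intros u. now rewrite <- (mult_1_r G u), <- H, mult_0_r. }
  now rewrite (Z s), (Z t).
Qed.

(** Stated for all substitution instances so that the induction on [A] passes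
    through the quantifiers. *)
Lemma ex_falso_subst A : forall G s, G ⊢ Bot -> G ⊢ subst s A.
Proof.
  induction A; intros G s0 H; cbn [subst].
  - now apply eq_of_bot.
  - apply prv_andI; auto.
  - apply prv_orI1; auto.
  - apply impI; enter K. auto.
  - apply allI; intros t. unfold inst. rewrite subst_comp. auto.
  - apply prv_exI with Zero. unfold inst. rewrite subst_comp. auto.
Qed.

Lemma ex_falso G A : G ⊢ Bot -> G ⊢ A.
Proof. intros H. rewrite <- (subst_id A Var) by reflexivity. now apply ex_falso_subst. Qed.

(** Induction on [s], with [t] universally quantified inside the formula because
    the step applies the induction hypothesis to the predecessor of [t]. *)
Lemma eq_dec G s t : G ⊢ s == t \/ Neq s t.
Proof.
  enough (H : G ⊢ All (tlift s == Var 0 \/ Neq (tlift s) (Var 0))).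
  { apply (prv_allE _ _ _ t) in H. revert H; simpl_inst; auto. }
  revert s. apply (induction_rule G (All (Var 1 == Var 0 \/ Neq (Var 1) (Var 0)))).
  - reflexivity.
  - apply allI; intros u; simpl_inst. apply (term_cases G u); [enter E|enter v E].
    + apply prv_orI1. now apply eq_sym.
    + apply prv_orI2, impI; enter K. change (eqv G Zero u) in K.
      apply (succ_zero G v). now rewrite <- E.
  - enter s IH. apply allI; intros u; simpl_inst.
    apply (term_cases G u); [enter E|enter v E].
    + apply prv_orI2, impI; enter K. change (eqv G (Succ s) u) in K.
      apply (succ_zero G s). now rewrite K.
    + apply (prv_allE _ _ _ v) in IH. revert IH; simpl_inst; intros IH.
      apply (orE _ _ _ _ IH); enter K.
      * apply prv_orI1. change (eqv G s v) in K. change (eqv G (Succ s) u).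
        now rewrite E, K.
      * apply prv_orI2, impI; enter E'. apply (prv_impE _ _ _ _ K).
        apply succ_inj. now rewrite <- E.
Qed.

(** * Order and bounded search *)

Lemma Lt_0_r G s : G ⊢ Lt s Zero -> G ⊢ Bot.
Proof.
  intros H. apply (Lt_elim _ _ _ _ H); enter k E.
  apply (succ_zero G (Plus s k)). now rewrite <- plus_succ_r.
Qed.

Lemma Lt_succ_r G s t : G ⊢ Lt s (Succ t) -> G ⊢ Lt s t \/ s == t.
Proof.
  intros H. apply (Lt_elim _ _ _ _ H); enter k E.
  rewrite plus_succ_r in E. apply succ_inj in E.
  apply (term_cases G k); [enter K|enter u K]; rewrite K in E.
  - apply prv_orI2. change (eqv G s t). now rewrite <- E, plus_0_r.
  - apply prv_orI1. now apply Lt_intro with u.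
Qed.

Lemma le_Lt_succ G s t : G ⊢ s == t \/ Lt s t -> G ⊢ Lt s (Succ t).
Proof.
  intros H. apply (orE _ _ _ _ H); enter K.
  - apply Lt_intro with Zero. rewrite plus_succ_r, plus_0_r.
    change (eqv G s t) in K. now rewrite K.
  - apply (Lt_elim _ _ _ _ K); enter k E. apply Lt_intro with (Succ k).
    now rewrite plus_succ_r, E.
Qed.

(** [B] is a positive substitute for the negation of [A]: for primality it is an
    implication between divisibility and a disjunction, which is used directly. *)
Lemma bounded_search G A B t :
  (forall u, G ⊢ inst A u \/ inst B u) ->
  G ⊢ Ex (Lt (Var 0) (tlift t) /\ A) \/ All (Lt (Var 0) (tlift t) ==> B).
Proof.
  intros D. revert t.
  apply (induction_rule G
    (Ex (Lt (Var 0) (Var 1) /\ at2 A 0) \/ All (Lt (Var 0) (Var 1) ==> at2 B 0))).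
  - intros t. unfold inst; cbn [subst]. now rewrite !subst_Lt, !subst_up_scons_at2.
  - apply prv_orI2. apply allI; intros u. simpl_inst.
    apply impI; enter L. apply ex_falso. eapply Lt_0_r; eauto.
  - enter t IH. apply (orE _ _ _ _ IH); enter K.
    + apply (exE _ _ _ K); enter u H. revert H; simpl_inst; intros H.
      apply prv_orI1. apply prv_exI with u. simpl_inst. apply prv_andI.
      * apply le_Lt_succ, prv_orI2. eapply prv_andE1; eauto.
      * eapply prv_andE2; eauto.
    + apply (orE _ _ _ _ (D t)); enter Ht.
      * apply prv_orI1. apply prv_exI with t. simpl_inst. apply prv_andI; [|assumption].
        apply le_Lt_succ, prv_orI1, prv_eqI.
      * apply prv_orI2. apply allI; intros u. simpl_inst. apply impI; enter L.
        apply (orE _ _ _ _ (Lt_succ_r _ _ _ L)); enter L'.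
        -- apply (prv_allE _ _ _ u) in K. revert K; simpl_inst; intros K.
           eapply prv_impE; eauto.
        -- apply (prv_eqE _ _ _ t); [now apply eq_sym|assumption].
Qed.

(** * Divisibility *)

Lemma divides_trans G s t u : G ⊢ Divides s t -> G ⊢ Divides t u -> G ⊢ Divides s u.
Proof.
  intros H K.
  apply (Divides_elim _ _ _ _ H); enter a Ha.
  apply (Divides_elim _ _ _ _ K); enter b Hb.
  apply Divides_intro with (Mult a b). now rewrite mult_assoc, Ha.
Qed.

(** If [t = u + 1], then [x = s + s * u], and the two cases are [s * u = 0] and
    [s * u > 0]. If [t = 0], then [x = 0]. *)
Lemma factor_le G s t x : G ⊢ Neq x Zero -> eqv G (Mult s t) x -> G ⊢ s == x \/ Lt s x.
Proof.
  intros N E. apply (term_cases G t); [enter Ht|enter u Ht]; rewrite Ht in E.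
  - apply ex_falso, (prv_impE _ _ _ _ N). change (eqv G x Zero).
    now rewrite <- E, mult_0_r.
  - rewrite mult_succ_r, plus_comm in E.
    apply (term_cases G (Mult s u)); [enter K|enter v K]; rewrite K in E.
    + apply prv_orI1. now rewrite plus_0_r in E.
    + apply prv_orI2. now apply Lt_intro with v.
Qed.

(** A cofactor of [s] in [x] is itself a factor of [x], hence at most [x], so
    the search may stop there. *)
Lemma divides_dec G s x : G ⊢ Neq x Zero -> G ⊢ Divides s x \/ (Divides s x ==> Bot).
Proof.
  intros N.
  pose (A := (Mult (tlift s) (Var 0) == tlift x)%form).
  assert (K : G ⊢ Ex (Lt (Var 0) (tlift (Succ x)) /\ A)
                  \/ All (Lt (Var 0) (tlift (Succ x)) ==> A ==> Bot)).
  { apply bounded_search. intros u. apply eq_dec. }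
  apply (orE _ _ _ _ K); clear K; enter K.
  - apply prv_orI1. apply (exE _ _ _ K); enter u E.
    revert E; unfold A; simpl_inst; intros E. apply prv_andE2 in E.
    now apply Divides_intro with u.
  - apply prv_orI2. apply impI; enter H.
    apply (Divides_elim _ _ _ _ H); enter u E.
    apply (prv_allE _ _ _ u) in K. revert K; unfold A; simpl_inst; intros K.
    eapply prv_impE; [apply (prv_impE _ _ _ _ K)|exact E].
    apply le_Lt_succ, (factor_le _ _ s); [assumption|]. now rewrite mult_comm.
Qed.

(** * Primes *)

Lemma Lt_One_Neq_Zero G x : G ⊢ Lt One x -> G ⊢ Neq x Zero.
Proof.
  intros H. apply impI; enter K. change (eqv G x Zero) in K.
  apply (Lt_elim _ _ _ _ H); enter k E.
  apply (succ_zero G (Plus One k)). now rewrite <- plus_succ_r, E.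
Qed.

(** Search below [x + 1] for a divisor [u] other than [1] and [x]. If the search
    fails, the bound may be dropped, because every divisor of [x] is at most
    [x]. *)
Lemma prime_or_coprime G x : G ⊢ Lt One x -> G ⊢ Prime x \/ Coprime x.
Proof.
  intros L. pose proof (Lt_One_Neq_Zero _ _ L) as N.
  pose (A := (Divides (Var 0) (tlift x) /\ Neq (Var 0) One /\ Neq (Var 0) (tlift x))%form).
  pose (B := (Divides (Var 0) (tlift x) ==> Var 0 == One \/ Var 0 == tlift x)%form).
  assert (K : G ⊢ Ex (Lt (Var 0) (tlift (Succ x)) /\ A)
                  \/ All (Lt (Var 0) (tlift (Succ x)) ==> B)).
  { apply bounded_search. intros u. unfold A, B. simpl_inst.
    apply (orE _ _ _ _ (eq_dec G u One)); enter E1.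
    { apply prv_orI2, impI; enter D. now apply prv_orI1. }
    apply (orE _ _ _ _ (eq_dec G u x)); enter Ex.
    { apply prv_orI2, impI; enter D. now apply prv_orI2. }
    apply (orE _ _ _ _ (divides_dec G u x N)); enter D.
    - apply prv_orI1. auto using prv_andI.
    - apply prv_orI2, impI; enter D'. apply ex_falso.
      eapply prv_impE; eauto. }
  apply (orE _ _ _ _ K); clear K; enter K.
  - apply prv_orI2, prv_andI; [assumption|].
    apply (exE _ _ _ K); enter u H. apply prv_exI with u.
    eapply prv_andE2. exact H.
  - apply prv_orI1, prv_andI; [assumption|]. apply allI; intros u. simpl_inst.
    apply impI; enter D.
    apply (prv_allE _ _ _ u) in K. unfold B in K. revert K; simpl_inst; intros K.
    eapply prv_impE; [apply (prv_impE _ _ _ _ K)|exact D].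
    apply (Divides_elim _ _ _ _ D); enter v E.
    eapply le_Lt_succ, factor_le; eauto.
Qed.

Lemma proper_divisor_bounds G y x :
  G ⊢ Neq x Zero -> G ⊢ Divides y x -> G ⊢ Neq y One -> G ⊢ Neq y x ->
  G ⊢ Lt One y /\ Lt y x.
Proof.
  intros N D N1 Nx.
  apply (Divides_elim _ _ _ _ D); enter z E.
  apply prv_andI.
  - apply (term_cases G y); [enter K|enter u K].
    { apply ex_falso, (prv_impE _ _ _ _ N). change (eqv G x Zero).
      now rewrite <- E, K, mult_0_l. }
    apply (term_cases G u); [enter K'|enter v K']; rewrite K' in K.
    { apply ex_falso, (prv_impE _ _ _ _ N1). exact K. }
    apply Lt_intro with v. unfold One.
    now rewrite plus_succ_l, plus_0_l.
  - apply (orE _ _ _ _ (factor_le _ _ _ _ N E)); enter K; [|assumption].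
    apply ex_falso. eapply prv_impE; eauto.
Qed.

Theorem proposition3p2 :
  prv arith nil
    (All (Coprime (Var 0) ==> Ex (Prime (Var 0) /\ Divides (Var 0) (Var 1)))).
Proof.
  apply allI; intros n.
  enough (H : nil ⊢ Coprime n ==> Ex (Prime (Var 0) /\ Divides (Var 0) (tlift n))).
  { revert H. unfold Coprime. simpl_inst. auto. }
  apply impI; intros G _ L. apply prv_andE1 in L.
  apply exWF with (Lt One (Var 0) /\ Divides (Var 0) (tlift n))%form.
  - apply prv_exI with n. simpl_inst. apply prv_andI; [assumption|].
    apply Divides_intro with One. apply mult_1_r.
  - enter x H. clear L. revert H; simpl_inst; intros H.
    pose proof (prv_andE1 _ _ _ _ H) as L. apply prv_andE2 in H.
    apply (orE _ _ _ _ (prime_or_coprime _ _ L)); enter K.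
    + apply prv_orI1. auto using prv_andI.
    + apply prv_orI2. apply prv_andE2 in K.
      apply (exE _ _ _ K); enter y Hy. revert Hy; simpl_inst; intros Hy.
      pose proof (prv_andE1 _ _ _ _ Hy) as D. apply prv_andE2 in Hy.
      assert (B : G ⊢ Lt One y /\ Lt y x).
      { apply proper_divisor_bounds; eauto using Lt_One_Neq_Zero, prv_andE1, prv_andE2. }
      apply prv_exI with y. simpl_inst.
      apply prv_andI; [|apply prv_andI]; eauto using prv_andE1, prv_andE2, divides_trans.
Qed.
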